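(* Let $A_0=1.5238\ldots$ be the real solution of $A-\tfrac12 e^{-2A}=\tfrac32$. For each $n$, throw $t$ distinguishable pebbles onto the $n$ vertices of the complete graph $K_n$ according to the Maxwell Boltzmann scheme. Let $\varphi(n)\to\infty$ be arbitrary. If $t=A_0n+\varphi(n)\sqrt n$, then $\mathbb{P}(K_n \text{ is cover solvable})\to 1$ as $n\to\infty$; and if $t=A_0n-\varphi(n)\sqrt n$, then $\mathbb{P}(K_n \text{ is cover solvable})\to 0$ as $n\to\infty$.
   Context: A configuration on a graph $G$ is a function $C:V(G)\to\mathbb{N}\cup\{0\}$ giving the number of pebbles on each vertex. A pebbling move removes two pebbles from some vertex and places one pebble on an adjacent vertex. A configuration is cover solvable if some finite sequence of (legal) pebbling moves results in at least one pebble on every vertex simultaneously; ''$K_n$ is cover solvable'' means the random configuration is cover solvable. In the Maxwell Boltzmann scheme the $t$ pebbles are distinct and each is placed independently and uniformly at random on one of the $n$ vertices, so all $n^t$ assignments are equally likely.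
   Formalization: The root of A − ½e^{−2A} = 3/2 is about 1.52374, so the printed digits 1.5238… are not its expansion; the formal statement asserts |A0 − 1.5238| < 10⁻⁴ instead, with t taken as the integer part of A0 n ± φ(n)√n. *)

(* Defs.v *)
From HB Require Import structures.
From mathcomp Require Import all_boot all_order all_algebra.
From mathcomp Require Import all_classical all_reals all_analysis.
Import Order.TTheory GRing.Theory Num.Theory.
Import numFieldNormedType.Exports.

Set Implicit Arguments.
Unset Strict Implicit.
Unset Printing Implicit Defensive.

Local Open Scope ring_scope.

(** Simple graphs are adjacency relations on a finite vertex type. *)

Definition configuration (V : finType) := {ffun V -> nat}.

(** For adjacent [u] and [v] one has [u != v], so the order of the two tests
    is immaterial. *)
Definition move_result (V : finType) (C : configuration V) (u v : V) :
    configuration V :=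
  [ffun w => if w == u then (C w - 2)%N
             else if w == v then (C w).+1 else C w].

(** The guard [2 <= C u] makes the move legal, so that the truncated subtraction
    in [move_result] is exact. *)
Definition pebbling_move (V : finType) (e : rel V) : rel (configuration V) :=
  fun C C' => [exists u : V, exists v : V,
    [&& e u v, (2 <= C u)%N & C' == move_result C u v]].

Definition cover_solvable (V : finType) (e : rel V) (C : configuration V) :
    Prop :=
  exists s : seq (configuration V),
    path (pebbling_move e) C s /\ forall v : V, (0 < last C s v)%N.

Definition complete_graph (n : nat) : rel 'I_n := fun u v => u != v.

(** [f i] is the vertex on which the [i]-th pebble is placed. *)
Definition pebble_count (n t : nat) (f : {ffun 'I_t -> 'I_n}) :
    configuration 'I_n :=
  [ffun v => #|[pred i | f i == v]|].

(** Maxwell Boltzmann scheme: the [n ^ t] placements of [t] distinct pebbles on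
    [n] vertices are equally likely. *)
Definition prob_cover_solvable (R : realType) (n t : nat) : R :=
  #|[pred f : {ffun 'I_t -> 'I_n} |
      `[< cover_solvable (@complete_graph n) (pebble_count f) >]]|%:R
    / (n ^ t)%:R.

(* Main.v *)
(** A move lowers [uphalf (C u)] by one and raises [uphalf (C v)] by at most one,
    and preserves [\sum_v uphalf (C v)] when [v] is empty; hence [C] is cover
    solvable on the complete graph iff [n <= \sum_v uphalf (C v)].  As
    [4 * uphalf c = 2 * c + 1 - (-1) ^ c], this says [S <= 2 t - 3 n] with
    [S = \sum_v (-1) ^ (C v)].  Each sign is a product over the pebbles, so
    [E S = n (1 - 2/n)^t], within a constant of [n exp (- 2 t / n)], and the covariance of two signs is
    [(1 - 4/n)^t - (1 - 2/n)^(2t) <= 0], whence [Var S <= n].  Since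
    [A - exp (- 2 A) / 2] has slope at least 1, a deviation of [t] from [A0 n] by
    [M sqrt n] puts [E S] at distance at least [M sqrt n] from [2 t - 3 n], and
    Chebyshev's inequality concludes. *)
Require Import Defs.
From HB Require Import structures.
From mathcomp Require Import all_boot all_order all_algebra.
From mathcomp Require Import all_classical all_reals all_analysis.
From mathcomp Require Import zify ring lra.
Import Order.TTheory GRing.Theory Num.Theory.
Import numFieldNormedType.Exports.

Set Implicit Arguments.
Unset Strict Implicit.
Unset Printing Implicit Defensive.

Local Open Scope classical_set_scope.
Local Open Scope ring_scope.

(** * Cover solvability on the complete graph *)

(* Both sides are moved so that no truncated subtraction of sums occurs. *)
Lemma move_result_sum (V : finType) (g : nat -> nat) (C : configuration V)
    (u v : V) : u != v ->
  (\sum_w g (move_result C u v w) + g (C u) + g (C v) =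
   \sum_w g (C w) + g (C u - 2) + g (C v).+1)%N.
Proof.
move=> uv; have vu : v != u by rewrite eq_sym.
rewrite (bigD1 u) // (bigD1 v) //= [in RHS](bigD1 u) // [in RHS](bigD1 v) //=.
rewrite !ffunE !eqxx (negbTE vu).
under eq_bigr => w /andP[/negbTE wu /negbTE wv] do rewrite ffunE wu wv.
lia.
Qed.

Lemma pebbling_move_uphalf (V : finType) (e : rel V) (C C' : configuration V) :
  irreflexive e -> pebbling_move e C C' ->
  (\sum_v uphalf (C' v) <= \sum_v uphalf (C v))%N.
Proof.
move=> irr /existsP[u /existsP[v /and3P[euv Cu /eqP ->]]].
have uv : u != v by apply: contraTneq euv => ->; rewrite irr.
have := move_result_sum uphalf C uv; lia.
Qed.

(** For the converse, induct on the number of empty vertices. If [v] is empty and every vertex holds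
    at most two pebbles, the sum falls below [#|V|]; so some [u] holds at least three, and the move
    from [u] to [v] keeps the sum, fills [v] and leaves [u] occupied. *)
Lemma cover_solvable_completeP (V : finType) (C : configuration V) :
  cover_solvable (fun u v => u != v) C <-> (#|V| <= \sum_v uphalf (C v))%N.
Proof.
have irr : irreflexive (fun u v : V => u != v) by move=> v; rewrite eqxx.
rewrite -sum1_card; split=> [[s [ps cov]]|].
  have mono : (\sum_v uphalf (last C s v) <= \sum_v uphalf (C v))%N.
    elim: s C ps {cov} => //= C' s IH C /andP[CC' /IH]/leq_trans; apply.
    exact: pebbling_move_uphalf CC'.
  by apply: leq_trans mono; apply: leq_sum => v _; rewrite uphalf_gt0.
have [m] := ubnP (\sum_v (C v == 0%N)); elim: m C => // m IH C Cm Cn.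
have [/existsP[v /eqP Cv]|/existsPn noempty] := boolP [exists v, C v == 0%N]; last first.
  by exists [::]; split=> // v; rewrite lt0n noempty.
have [/existsP[u Cu]|/existsPn small] := boolP [exists u, 3 <= C u]%N; last first.
  suff : (\sum_v uphalf (C v) < \sum_(v : V) 1)%N by rewrite ltnNge Cn.
  rewrite (bigD1 v) //= Cv /= add0n [ltnRHS](bigD1 v) //= ltnS.
  by apply: leq_sum => u _; have := small u; lia.
have uv : u != v by apply: contraTneq Cu => ->; rewrite Cv.
have sE := move_result_sum uphalf C uv.
have zE := move_result_sum (fun c => nat_of_bool (c == 0%N)) C uv.
have [||s [ps cov]] := IH (move_result C u v).
- by move: zE; rewrite Cv /=; lia.
- by apply: leq_trans Cn _; move: sE; rewrite Cv /=; lia.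
exists (move_result C u v :: s); split=> //=; rewrite ps andbT.
by apply/existsP; exists u; apply/existsP; exists v; rewrite uv eqxx (ltnW Cu).
Qed.

(** * Moments of the parity sum and Chebyshev's inequality *)

Section Parity.
Variables (R : realType) (n t : nat).
Implicit Types f : {ffun 'I_t -> 'I_n}.

Definition parity_sign (v : 'I_n) f : R := \prod_i (-1) ^+ (f i == v).

Definition parity_sum f : R := \sum_v parity_sign v f.

Lemma parity_signE v f : parity_sign v f = (-1) ^+ pebble_count f v.
Proof.
rewrite /parity_sign prodrXr ffunE -sum1_card [in RHS]big_mkcond /=.
by congr (_ ^+ _); apply: eq_bigr => i _; rewrite inE; case: eqP.
Qed.

Lemma sum_pebble_count f : (\sum_v pebble_count f v = t)%N.
Proof.
under eq_bigr => v _ do rewrite ffunE -sum1_card.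
rewrite -[RHS]card_ord -sum1_card (partition_big f xpredT) //=.
Qed.

Lemma cover_solvable_parity_sum f :
  cover_solvable (@complete_graph n) (pebble_count f) <->
  parity_sum f <= 2 * t%:R - 3 * n%:R.
Proof.
have signE v : parity_sign v f =
    1 + 2 * (pebble_count f v)%:R - 4 * (uphalf (pebble_count f v))%:R.
  rewrite parity_signE -signr_odd; set c := pebble_count f v.
  have : (uphalf c).*2 = (odd c + c)%N by lia.
  move=> /(congr1 (fun k => k%:R : R)); rewrite -mul2n natrM natrD.
  by case: (odd c) => /= e; lra.
have -> : parity_sum f =
    n%:R + 2 * t%:R - 4 * (\sum_v uphalf (pebble_count f v))%:R.
  rewrite /parity_sum (eq_bigr _ (fun v _ => signE v)) sumrB big_split /=.
  rewrite -!mulr_sumr -!natr_sum sum_pebble_count sumr_const card_ord.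
  by [].
have := cover_solvable_completeP (pebble_count f).
by rewrite card_ord -(ler_nat R) => ->; split; lra.
Qed.

(** By distributivity the sum is the [t]-th power of a one-pebble sum, which has one term -1 and n -
    1 terms 1. *)
Lemma sum_parity_sign v :
  \sum_f parity_sign v f = (n%:R - 2) ^+ t.
Proof.
rewrite /parity_sign -(bigA_distr_bigA (fun (i : 'I_t) j => (-1) ^+ (j == v))) /=.
rewrite prodr_const card_ord; congr (_ ^+ _).
rewrite (bigD1 v) //= eqxx (eq_bigr (fun=> 1)); last by move=> j /negbTE ->.
have := sumr_const (pred_of_simpl (@predT 'I_n)) (1 : R).
by rewrite card_ord (bigD1 v) //= => <-; ring.
Qed.

(** As for one sign, but the one-pebble sum now has two terms -1. *)
Lemma sum_parity_sign2 v w : v != w ->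
  \sum_f parity_sign v f * parity_sign w f = (n%:R - 4) ^+ t.
Proof.
move=> vw.
under eq_bigr => f _ do rewrite /parity_sign -big_split /=.
rewrite -(bigA_distr_bigA (fun (i : 'I_t) j => (-1) ^+ (j == v) * (-1) ^+ (j == w))) /=.
rewrite prodr_const card_ord; congr (_ ^+ _).
have wv : w != v by rewrite eq_sym.
rewrite (bigD1 v) // (bigD1 w) //= !eqxx (negbTE vw) (negbTE wv).
rewrite (eq_bigr (fun=> 1)); last first.
  by move=> j /andP[/negbTE -> /negbTE ->]; rewrite mulr1.
have := sumr_const (pred_of_simpl (@predT 'I_n)) (1 : R).
by rewrite card_ord (bigD1 v) // (bigD1 w) //= => <-; ring.
Qed.

Lemma sum_parity_sum : \sum_f parity_sum f = n%:R * (n%:R - 2) ^+ t.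
Proof.
rewrite exchange_big /= (eq_bigr _ (fun v _ => sum_parity_sign v)).
by rewrite sumr_const card_ord -[LHS]mulr_natl.
Qed.

(** The diagonal terms are squares of signs, hence 1 for each placement; the n (n - 1) others come
    from [sum_parity_sign2]. *)
Lemma sum_parity_sum2 : \sum_f parity_sum f ^+ 2 =
  n%:R * n%:R ^+ t + n%:R * (n%:R - 1) * (n%:R - 4) ^+ t.
Proof.
have -> : \sum_f parity_sum f ^+ 2 =
    \sum_v \sum_w \sum_f parity_sign v f * parity_sign w f.
  under eq_bigr => f _ do
    (rewrite expr2 /parity_sum big_distrlr /=).
  by rewrite exchange_big; apply: eq_bigr => v _; rewrite exchange_big.
have -> : n%:R * n%:R ^+ t + n%:R * (n%:R - 1) * (n%:R - 4) ^+ t =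
  \sum_(v < n) (n%:R ^+ t + (n%:R - 1) * (n%:R - 4) ^+ t) :> R.
  by rewrite sumr_const card_ord -[RHS]mulr_natl; ring.
apply: eq_bigr => v _; rewrite (bigD1 v) //=; congr (_ + _).
  under eq_bigr => f _ do rewrite parity_signE -expr2 sqrr_sign.
  by rewrite sumr_const card_ffun !card_ord natrX.
rewrite (eq_bigr (fun=> (n%:R - 4) ^+ t)); last first.
  by move=> w wv; rewrite sum_parity_sign2 // eq_sym.
have := sumr_const (pred_of_simpl (@predT 'I_n)) ((n%:R - 4) ^+ t : R).
by rewrite card_ord (bigD1 v) //= -[RHS]mulr_natl mulrBl mul1r => <-; ring.
Qed.

(** The expectation of [parity_sum]: the total in [sum_parity_sum] divided by n^t. *)
Definition mean_parity_sum : R := n%:R * (1 - 2 / n%:R) ^+ t.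

Lemma sum_parity_sum_centered : (4 <= n)%N ->
  \sum_f (parity_sum f - mean_parity_sum) ^+ 2 <= n%:R * (n ^ t)%:R.
Proof.
move=> n4; set mu := mean_parity_sum.
have n4R : 4 <= n%:R :> R by rewrite (ler_nat R 4).
have n0 : n%:R != 0 :> R by apply/lt0r_neq0; lra.
have muE : (n%:R - 2) ^+ t = (1 - 2 / n%:R) ^+ t * n%:R ^+ t :> R.
  by rewrite -exprMn; congr (_ ^+ _); field.
have -> : \sum_f (parity_sum f - mu) ^+ 2 =
    \sum_f parity_sum f ^+ 2 - 2 * mu * \sum_f parity_sum f + mu ^+ 2 * n%:R ^+ t.
  have -> : mu ^+ 2 * n%:R ^+ t = \sum_(f : {ffun 'I_t -> 'I_n}) mu ^+ 2.
    by rewrite sumr_const card_ffun !card_ord -[RHS]mulr_natr natrX.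
  rewrite mulr_sumr -sumrB -big_split /=; apply: eq_bigr => f _; ring.
rewrite sum_parity_sum sum_parity_sum2 muE natrX /mu /mean_parity_sum.
(* Nonpositive covariance: n (1 - 2/n)^2 exceeds n - 4 by 4/n, and n >= 4 keeps the bases
   nonnegative, so the power [t] preserves the order. *)
have : (n%:R - 4) ^+ t <= n%:R ^+ t * ((1 - 2 / n%:R) ^+ t) ^+ 2 :> R.
  rewrite exprAC -exprMn lerXn2r ?nnegrE //.
  - lra.
  - by apply: mulr_ge0; [lra | exact: sqr_ge0].
  - have -> : n%:R * (1 - 2 / n%:R) ^+ 2 = n%:R - 4 + 4 / n%:R :> R by field.
    by rewrite lerDl; apply: divr_ge0; lra.
have : 0 <= n%:R ^+ t * ((1 - 2 / n%:R) ^+ t) ^+ 2 :> R.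
  by apply: mulr_ge0; [apply: exprn_ge0; lra | exact: sqr_ge0].
set p := (_ - 4) ^+ t; set q := (1 - _) ^+ t; set N := _ ^+ t => q0 pq.
have : n%:R * (n%:R - 1) * p <= n%:R * (n%:R - 1) * (N * q ^+ 2).
  by apply: ler_wpM2l => //; apply: mulr_ge0; lra.
have : 0 <= n%:R * (N * q ^+ 2) by apply: mulr_ge0 => //; lra.
lra.
Qed.

(** The threshold is g standard deviations when the variance is bounded by n, so n cancels. An
    arbitrary [P] serves both tails. *)
Lemma parity_sum_chebyshev (P : pred {ffun 'I_t -> 'I_n}) (g : R) :
  (4 <= n)%N -> 0 < g ->
  (forall f, P f -> g * Num.sqrt n%:R <= `|parity_sum f - mean_parity_sum|) ->
  #|P|%:R / (n ^ t)%:R <= g ^- 2.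
Proof.
move=> n4 g0 Pg.
have n0 : 0 < n%:R :> R by rewrite ltr0n; lia.
have N0 : 0 < (n ^ t)%:R :> R by rewrite ltr0n expn_gt0; lia.
rewrite ler_pdivrMr // mulrC -(ler_pM2r (exprn_gt0 2 g0)) mulfVK; last first.
  by rewrite expf_neq0 // gt_eqF.
rewrite -(ler_pM2l n0) (le_trans _ (sum_parity_sum_centered n4)) //.
have -> : n%:R * (#|P|%:R * g ^+ 2) = \sum_(f | P f) (g ^+ 2 * n%:R).
  rewrite sumr_const -mulr_natl.
  ring.
rewrite big_mkcond; apply: ler_sum => f _; case: ifP => [/Pg Pf|_]; last exact: sqr_ge0.
rewrite -(sqr_sqrtr (ltW n0)) -exprMn -[leRHS]real_normK ?num_real //.
by rewrite lerXn2r ?nnegrE // mulr_ge0 ?sqrtr_ge0 // ltW.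
Qed.

End Parity.

(** * The constant A0 and estimates of the mean *)

Section Threshold.
Variable R : realType.

Definition threshold_fun (A : R) : R := A - 1 / 2 * expR (- (2 * A)).

Lemma threshold_funB (a b : R) : a <= b ->
  b - a <= threshold_fun b - threshold_fun a.
Proof.
move=> ab; have : expR (- (2 * b)) <= expR (- (2 * a)) by rewrite ler_expR; lra.
rewrite /threshold_fun; lra.
Qed.

Lemma threshold_fun_inj : injective threshold_fun.
Proof.
move=> a b ab; apply/eqP; rewrite eq_le.
by apply/andP; split; rewrite leNgt; apply/negP => lt_ab;
  have := threshold_funB (ltW lt_ab); lra.
Qed.

(** One squaring step of the numerical evaluation, with [q] the rounded-down square of [p]. *)
Lemma expR_double_ge (x p q : R) : 0 <= p -> q <= p ^+ 2 ->
  p <= expR (x / 2) -> q <= expR x.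
Proof.
move=> p0 qp px; apply: (le_trans qp).
have -> : expR x = expR (x / 2) ^+ 2 by rewrite -expRM_natl; congr expR; field.
by rewrite lerXn2r // nnegrE expR_ge0.
Qed.

(* The numerical bounds come from [1 + x <= expR x] at [x / 2 ^ k], squared [k]
   times with rounding.  Digits are grouped by three because numerals of the ring
   are unary. *)
Local Notation dec a b c := (a / 10 ^+ 3 + b / 10 ^+ 6 + c / 10 ^+ 9).

(** Equivalent to [threshold_fun A < 3 / 2] at A = 1.5237, since 0.0474 = 2 A - 3. *)
Lemma expR_lower_bound : 474 / 10 ^+ 4 < expR (- dec 3047 400 0) :> R.
Proof.
apply: (@lt_le_trans _ _ (dec 47 428 0)); first lra.
apply: (@expR_double_ge _ (dec 217 779 971)); [lra|lra|].
apply: (@expR_double_ge _ (dec 466 669 17)); [lra|lra|].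
apply: (@expR_double_ge _ (dec 683 131 772)); [lra|lra|].
apply: (@expR_double_ge _ (dec 826 517 860)); [lra|lra|].
apply: (@expR_double_ge _ (dec 909 130 277)); [lra|lra|].
apply: (@expR_double_ge _ (dec 953 483 234)); [lra|lra|].
apply: (@expR_double_ge _ (dec 976 464 661)); [lra|lra|].
apply: (@expR_double_ge _ (dec 988 162 265)); [lra|lra|].
apply: (@expR_double_ge _ (dec 994 63 512)); [lra|lra|].
apply: (@expR_double_ge _ (dec 997 27 338)); [lra|lra|].
apply: (@expR_double_ge _ (dec 998 512 563)); [lra|lra|].
apply: (@expR_double_ge _ (dec 999 256 5)); [lra|lra|].
by apply: le_trans (expR_ge1Dx _); lra.
Qed.

(** Equivalent to [threshold_fun A > 3 / 2] at A = 1.5239, since 0.0478 = 2 A - 3. *)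
Lemma expR_upper_bound : expR (- dec 3047 800 0) < 478 / 10 ^+ 4 :> R.
Proof.
(* The squaring method gives only lower bounds, so the reciprocal is bounded below; 1 / 21.02 <
   0.0478. *)
suff e : 2102 / 10 ^+ 2 <= expR (dec 3047 800 0) :> R.
  have := expRxMexpNx_1 (dec 3047 800 0 : R); move: e.
  have := expR_gt0 (- dec 3047 800 0 : R).
  set x := expR (- _); set y := expR _ => x0 e xy; nra.
apply: (@expR_double_ge _ (dec 4584 888 772)); [lra|lra|].
apply: (@expR_double_ge _ (dec 2141 235 338)); [lra|lra|].
apply: (@expR_double_ge _ (dec 1463 296 53)); [lra|lra|].
apply: (@expR_double_ge _ (dec 1209 667 745)); [lra|lra|].
apply: (@expR_double_ge _ (dec 1099 848 965)); [lra|lra|].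
apply: (@expR_double_ge _ (dec 1048 736 843)); [lra|lra|].
apply: (@expR_double_ge _ (dec 1024 78 534)); [lra|lra|].
apply: (@expR_double_ge _ (dec 1011 967 655)); [lra|lra|].
apply: (@expR_double_ge _ (dec 1005 966 31)); [lra|lra|].
apply: (@expR_double_ge _ (dec 1002 978 580)); [lra|lra|].
apply: (@expR_double_ge _ (dec 1001 488 183)); [lra|lra|].
by apply: le_trans (expR_ge1Dx _); lra.
Qed.

(** Intermediate value theorem on the bracket of radius 10^-4 about 1.5238, which also certifies the
    printed decimals. *)
Lemma threshold_exists : exists2 A : R,
  dec 1523 700 0 < A < dec 1523 900 0 & threshold_fun A = 3 / 2.
Proof.
pose a : R := dec 1523 700 0; pose b : R := dec 1523 900 0.
have fa : threshold_fun a < 3 / 2.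
  rewrite /threshold_fun /a; have := expR_lower_bound.
  have -> : 2 * dec 1523 700 0 = dec 3047 400 0 :> R by lra.
  lra.
have fb : 3 / 2 < threshold_fun b.
  rewrite /threshold_fun /b; have := expR_upper_bound.
  have -> : 2 * dec 1523 900 0 = dec 3047 800 0 :> R by lra.
  lra.
have ab : a <= b by rewrite /a /b; lra.
have fab : Num.min (threshold_fun a) (threshold_fun b) <= 3 / 2 <=
    Num.max (threshold_fun a) (threshold_fun b).
  by rewrite ge_min le_max (ltW fa) (ltW fb) orbT.
have cf : {within `[a, b], continuous threshold_fun}.
  apply: continuous_subspaceT => x; apply: cvgB; first exact: cvg_id.
  apply: cvgM; first exact: cvg_cst.
  apply: (@cvg_comp _ _ _ (fun y : R => - (2 * y)) (@expR R)); last exact: continuous_expR.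
  by apply: cvgN; apply: cvgM; [exact: cvg_cst|exact: cvg_id].
have [A] := IVT ab cf fab; rewrite in_itv /= => /andP[aA Ab] fA.
exists A => //; rewrite !lt_neqAle -!andbA; apply/and4P; split=> //.
- by apply: contraTneq fa; rewrite -/a => ->; rewrite fA ltxx.
- by apply: contraTneq fb; rewrite -/b => <-; rewrite fA ltxx.
Qed.

(** From 1 + x <= exp x at x = -2/n, raised to the power [t]. *)
Lemma mean_parity_sum_le (n t : nat) : (4 <= n)%N ->
  mean_parity_sum R n t <= n%:R * expR (- (2 * (t%:R / n%:R))).
Proof.
move=> n4; have n4R : 4 <= n%:R :> R by rewrite (ler_nat R 4).
have n0 : n%:R != 0 :> R by apply/lt0r_neq0; lra.
rewrite /mean_parity_sum ler_wpM2l //.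
have -> : - (2 * (t%:R / n%:R)) = t%:R * (- (2 / n%:R)) :> R by field.
rewrite expRM_natl lerXn2r ?nnegrE ?expR_ge0 ?expR_ge1Dx //.
by rewrite subr_ge0 ler_pdivrMr; lra.
Qed.

(** Here 1 - 2/n is the inverse of 1 + 2/(n - 2), hence at least exp (-2/(n - 2)); the cost of
    replacing n - 2 by n in the exponent stays bounded after multiplication by n. *)
Lemma mean_parity_sum_ge (n t : nat) (A : R) : (4 <= n)%N -> t%:R <= A * n%:R ->
  n%:R * expR (- (2 * (t%:R / n%:R))) - 8 * A <= mean_parity_sum R n t.
Proof.
move=> n4 tA; have n4R : 4 <= n%:R :> R by rewrite (ler_nat R 4).
have n0 : n%:R != 0 :> R by apply/lt0r_neq0; lra.
have n2 : n%:R - 2 != 0 :> R by apply/lt0r_neq0; lra.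
have n2V : 0 < (n%:R - 2)^-1 :> R by rewrite invr_gt0; lra.
have A0 : 0 <= A by have := le_trans (ler0n R t) tA; rewrite pmulr_lge0 //; lra.
have step : expR (- (2 / (n%:R - 2))) <= 1 - 2 / n%:R :> R.
  have -> : 1 - 2 / n%:R = (1 + 2 / (n%:R - 2))^-1 :> R.
    by field; rewrite n2 subrK n0.
  rewrite expRN lef_pV2 ?posrE ?expR_gt0 ?expR_ge1Dx //.
  by have := mulr_gt0 (ltr0n R 2) n2V; lra.
set a := 2 * (t%:R / n%:R).
have a0 : 0 <= a by rewrite /a mulr_ge0 // divr_ge0.
(* The exponents differ by 4 t / (n (n - 2)), at most [d] because t <= A n. *)
pose d : R := 4 * A / (n%:R - 2).
have le1 : expR (- a) * (1 - d) <= expR (t%:R * (- (2 / (n%:R - 2)))).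
  apply: (@le_trans _ _ (expR (- a - d))).
    by rewrite expRD ler_wpM2l ?expR_ge0 // expR_ge1Dx.
  rewrite ler_expR -subr_ge0.
  have -> : t%:R * - (2 / (n%:R - 2)) - (- a - d) =
     4 * (A * n%:R - t%:R) / n%:R / (n%:R - 2).
    rewrite /a /d; field.
    by rewrite n0 n2.
  by rewrite !divr_ge0 //; lra.
have le2 : expR (t%:R * (- (2 / (n%:R - 2)))) <= (1 - 2 / n%:R) ^+ t :> R.
  rewrite expRM_natl lerXn2r ?nnegrE ?expR_ge0 //.
  by apply: le_trans step; exact: expR_ge0.
have e1 : expR (- a) <= 1 by rewrite -expR0 ler_expR; lra.
(* Uses n <= 2 (n - 2), valid for n >= 4. *)
have nd : 0 <= n%:R * d <= 8 * A.
  rewrite /d; apply/andP; split.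
    by rewrite !mulr_ge0 //; lra.
  rewrite mulrA ler_pdivrMr; last by lra.
  have : 0 <= A * (n%:R - 4) by apply: mulr_ge0; lra.
  lra.
rewrite /mean_parity_sum.
have : n%:R * (expR (- a) * (1 - d)) <= n%:R * (1 - 2 / n%:R) ^+ t.
  by rewrite ler_wpM2l // (le_trans le1).
have : expR (- a) * (n%:R * d) <= 1 * (8 * A).
  by apply: ler_pM; rewrite ?expR_ge0 //; case/andP: nd.
lra.
Qed.
End Threshold.

(** * Tail bounds at distance M sqrt n from the threshold *)

Section Tails.
Variables (R : realType) (A : R).
Hypothesis A_threshold : threshold_fun A = 3 / 2.

(** Chebyshev is applied to the unsolvable placements: the slope bound puts the mean at least 2 (t -
    A n) >= 2 M sqrt n below 2 t - 3 n. *)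
Lemma prob_cover_solvable_ge (n t : nat) (M : R) : (4 <= n)%N -> 0 < M ->
  A * n%:R + M * Num.sqrt n%:R <= t%:R ->
  1 - (2 * M) ^- 2 <= prob_cover_solvable R n t.
Proof.
move=> n4 M0 tM; have n0 : 0 < n%:R :> R by rewrite ltr0n; lia.
have s0 : 0 <= M * Num.sqrt n%:R by rewrite mulr_ge0 // ltW.
have N0 : 0 < (n ^ t)%:R :> R by rewrite ltr0n expn_gt0; lia.
rewrite /prob_cover_solvable; set P := [pred f | _].
have -> : #|P|%:R / (n ^ t)%:R = 1 - #|[predC P]|%:R / (n ^ t)%:R :> R.
  have := cardC P; rewrite card_ffun !card_ord => /(congr1 (fun k => k%:R : R)).
  rewrite natrD => PN.
  by rewrite -[X in _ = X - _](divff (lt0r_neq0 N0)) -mulrBl -PN addrK.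
rewrite lerD2l lerN2; apply: parity_sum_chebyshev => //; first by lra.
move=> f; rewrite inE /= => /asboolPn; rewrite (cover_solvable_parity_sum R).
move=> /negP; rewrite -ltNge => St.
apply: le_trans (ler_norm _).
have := mean_parity_sum_le R t n4.
have At : A <= t%:R / n%:R by rewrite ler_pdivlMr //; lra.
have := threshold_funB At; rewrite A_threshold /threshold_fun.
rewrite -(ler_pM2l n0); set e := expR _.
have : n%:R * (t%:R / n%:R) = t%:R :> R by field; rewrite gt_eqF.
nra.
Qed.

(** The mean exceeds 2 t - 3 n by at least 2 M sqrt n - 8 A; the hypothesis on 8 A leaves M sqrt
    n. *)
Lemma prob_cover_solvable_le (n t : nat) (M : R) : (4 <= n)%N -> 0 < M ->
  8 * A <= M * Num.sqrt n%:R -> t%:R <= A * n%:R - M * Num.sqrt n%:R ->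
  prob_cover_solvable R n t <= M ^- 2.
Proof.
move=> n4 M0 AM tM; have n0 : 0 < n%:R :> R by rewrite ltr0n; lia.
have s0 : 0 <= M * Num.sqrt n%:R by rewrite mulr_ge0 // ltW.
apply: parity_sum_chebyshev => // f; rewrite inE /= => /asboolP.
rewrite (cover_solvable_parity_sum R) => St; rewrite distrC.
apply: le_trans (ler_norm _).
have tA : t%:R <= A * n%:R by lra.
have := mean_parity_sum_ge n4 tA.
have At : t%:R / n%:R <= A by rewrite ler_pdivrMr.
have := threshold_funB At; rewrite A_threshold /threshold_fun.
rewrite -(ler_pM2l n0); set e := expR _.
have : n%:R * (t%:R / n%:R) = t%:R :> R by field; rewrite gt_eqF.
nra.
Qed.

Lemma prob_cover_solvable_le1 (n t : nat) : prob_cover_solvable R n t <= 1.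
Proof.
(* If there are no placements, the quotient by zero is 0. *)
rewrite /prob_cover_solvable; have [->|N0] := posnP (n ^ t).
  by rewrite invr0 mulr0.
rewrite ler_pdivrMr ?ltr0n // mul1r ler_nat.
by apply: leq_trans (max_card _) _; rewrite card_ffun !card_ord.
Qed.

Lemma prob_cover_solvable_ge0 (n t : nat) : 0 <= prob_cover_solvable R n t.
Proof. by rewrite /prob_cover_solvable divr_ge0. Qed.

Lemma near_sqrt_ge (r : R) : \forall n \near \oo, r <= Num.sqrt (n%:R : R).
Proof.
near=> n; apply: le_trans (ler_norm r) _.
rewrite -(@sqrtr_sqr R r) ler_sqrt //.
by near: n; exact: nbhs_infty_ger.
Unshelve. all: by end_near. Qed.

End Tails.

(* MathComp-Analysis world. The integer number of pebbles is the floor of the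
   real expression for t (0 where that expression is negative);
   15 / 10 + 238 / 10 ^+ 4 is the printed decimal 1.5238 of A0. *)
Theorem theorem2 (R : realType) :
  exists A0 : R,
    [/\ A0 - 1 / 2 * expR (- (2 * A0)) = 3 / 2,
        forall A : R, A - 1 / 2 * expR (- (2 * A)) = 3 / 2 -> A = A0,
        `|A0 - (15 / 10 + 238 / 10 ^+ 4)| < 10 ^- 4 &
        forall phi : nat -> R, phi n @[n --> \oo] --> +oo ->
          (prob_cover_solvable R n
             (Num.truncn (A0 * n%:R + phi n * Num.sqrt n%:R))
             @[n --> \oo] --> (1 : R)) /\
          (prob_cover_solvable R n
             (Num.truncn (A0 * n%:R - phi n * Num.sqrt n%:R))
             @[n --> \oo] --> (0 : R))].
Proof.
have [A0 /andP[aA Ab] fA] := threshold_exists R.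
exists A0; split=> //.
- by move=> A fA'; apply: threshold_fun_inj; rewrite fA.
- rewrite ltr_distlC; apply/andP; split; lra.
move=> phi /cvgryPge phi_oo.
have inv_sq (e : R) : 0 < e -> exists2 M : R, 0 < M & M ^- 2 <= e.
  move=> e0; exists (1 + e^-1); first by rewrite addr_gt0 ?invr_gt0.
  have i0 : 0 < e^-1 by rewrite invr_gt0.
  rewrite -[leRHS]invrK lef_pV2 ?posrE ?exprn_gt0 //; first by nra.
  by lra.
split; apply/cvgrPdist_le => e e0; have [M M0 Me] := inv_sq e e0; near=> n.
all: have n4 : (4 <= n)%N by near: n; exact: nbhs_infty_ge.
- have s1 : 1 <= Num.sqrt n%:R :> R by near: n; exact: near_sqrt_ge.
  (* The extra 1 pays for the floor, which loses less than 1 <= sqrt n. *)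
  have phiM : M + 1 <= phi n by near: n; exact: phi_oo.
  set x := (X in Num.truncn X).
  have tM : A0 * n%:R + M * Num.sqrt n%:R <= (Num.truncn x)%:R.
    have := truncnS_gt x; rewrite -natr1 {1}/x.
    nra.
  have := prob_cover_solvable_ge fA n4 M0 tM.
  have M2 : (2 * M) ^- 2 <= e.
    apply: le_trans Me; rewrite lef_pV2 ?posrE ?exprn_gt0 //; last by lra.
    nra.
  have := prob_cover_solvable_le1 R n (Num.truncn x).
  by rewrite ler_distlC => ? ?; apply/andP; split; lra.
- have sM : 8 * A0 / M <= Num.sqrt n%:R :> R.
    by near: n; exact: near_sqrt_ge.
  (* Needed when the real expression is negative and the pebble count is therefore 0: it gives 0 <=
     A0 n - M sqrt n. *)
  have sA : M / A0 <= Num.sqrt n%:R :> R by near: n; exact: near_sqrt_ge.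
  have phiM : M <= phi n by near: n; exact: phi_oo.
  have s0 := sqrtr_ge0 (n%:R : R).
  have ss : Num.sqrt n%:R ^+ 2 = n%:R :> R by rewrite sqr_sqrtr.
  have A00 : 0 < A0 by lra.
  set x := (X in Num.truncn X).
  have tM : (Num.truncn x)%:R <= A0 * n%:R - M * Num.sqrt n%:R.
    have [x0|/ltW x0] := leP 0 x.
      have /andP[+ _] := truncn_itv x0; rewrite {2}/x; nra.
    have -> : Num.truncn x = 0%N by apply/truncn0Pn; rewrite -ltNge; lra.
    by move: sA; rewrite ler_pdivrMr // => /(ler_wpM2r s0) sA; rewrite -{1}ss; lra.
  have AM : 8 * A0 <= M * Num.sqrt n%:R.
    by move: sM; rewrite ler_pdivrMr //; lra.
  have := prob_cover_solvable_le fA n4 M0 AM tM.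
  have := prob_cover_solvable_ge0 R n (Num.truncn x).
  by rewrite sub0r normrN => ? ?; rewrite ger0_norm //; lra.
Unshelve. all: by end_near.
Qed.
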